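(* Let $G$ be a finite graph (loopless, multiple edges allowed), let $m$ be a positive integer, and let $g$, $f$, $f'$ be nonnegative integer-valued functions on $V(G)$ with $g\le f$, $m\le f$, and $m\le f'$ (pointwise). If $G$ contains a $(g,f)$-factor and an $m$-tree-connected $(m,f')$-factor, then $G$ contains an $m$-tree-connected $(g,f+f'-m)$-factor.
   Context: Graphs have no loops but may have multiple edges. A factor of $G$ is a spanning subgraph. For nonnegative integer-valued functions $a\le b$ on $V(G)$ (constants are viewed as constant functions), an $(a,b)$-factor is a spanning subgraph $F$ with $a(v)\le d_F(v)\le b(v)$ for every vertex $v$, where $d_F(v)$ is the number of edges of $F$ incident to $v$. A graph is $m$-tree-connected if it contains $m$ edge-disjoint spanning trees. *)

(* Defs.v *)
From mathcomp Require Import all_boot.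

Set Implicit Arguments.
Unset Strict Implicit.
Unset Printing Implicit Defensive.

(* Finite loopless multigraphs: distinct edges may have the same pair of ends.
   A spanning subgraph of G is given by its edge set F : {set edge G}. *)
Record mgraph := MGraph {
  vertex : finType;
  edge : finType;
  ends : edge -> {set vertex};
  card_ends : forall e, #|ends e| = 2
}.

Section Factors.
Variable G : mgraph.
Implicit Types (F T : {set edge G}) (v x y : vertex G).

Definition degree F v := #|[set e in F | v \in ends e]|.

Definition is_factor (a b : vertex G -> nat) F : Prop :=
  forall v, a v <= degree F v <= b v.

Definition adj F : rel (vertex G) :=
  fun x y => [exists e in F, ends e == [set x; y]].

Definition connected F : Prop := forall x y, connect (adj F) x y.

(* [:: (v_0, e_0); ...; (v_k-1, e_k-1)] stands for the closed walk
   v_0 e_0 v_1 ... v_k-1 e_k-1 v_0.  Two parallel edges form a cycle with k = 2;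
   k = 1 is impossible because e_0 would be a loop. *)
Definition is_cycle F (c : seq (vertex G * edge G)) : bool :=
  [&& c != [::], uniq (unzip1 c), uniq (unzip2 c),
      all (fun e => e \in F) (unzip2 c)
    & cycle (fun p q => ends p.2 == [set p.1; q.1]) c].

Definition acyclic F : Prop := forall c, ~~ is_cycle F c.

Definition spanning_tree T : Prop := connected T /\ acyclic T.

Definition tree_connected m F : Prop :=
  exists T : 'I_m -> {set edge G},
    [/\ forall i, T i \subset F,
        forall i, spanning_tree (T i)
      & forall i j, i != j -> [disjoint T i & T j]].

End Factors.

(* Main.v *)
(** Write d_F, d_M for the degrees of a (g,f)-factor F and an m-tree-connected
    (m,f')-factor M.  It suffices to find an m-tree-connected H inside F ∪ M
    with d_F <= d_H <= max(d_F, m) + d_M - m; call a vertex t small when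
    d_F(t) <= m.

    If some edge e of F \ M has no small end, solve the problem for F - e and
    add e to the solution: both bounds grow by one at both ends of e.

    Otherwise start from H = M.  If d_H(u) < d_F(u), pick an edge e of F \ H
    at u.  As d_H(u) >= m, the vertex u is not small, so the other end t of e
    is.  Fewer than m edges of F ∩ H meet t, so one of the m disjoint trees
    packed in H has no edge of F at t; in that tree, e can be exchanged for an
    edge e' at t.  Replacing e by e' in this way keeps the degree of t, and
    since e' is not in F it enlarges F ∩ H, so the process stops. *)

Require Import Defs.
From mathcomp Require Import all_boot.
From mathcomp Require Import zify.

Set Implicit Arguments.
Unset Strict Implicit.
Unset Printing Implicit Defensive.

(** * Connected edge sets: exchanging an edge, breaking cycles *)

Section Connectedness.
Variable G : mgraph.
Implicit Types (F T H : {set edge G}) (e : edge G) (v x y : vertex G).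

Lemma adj_sym F : symmetric (adj F).
Proof. by move=> x y; apply: eq_existsb => e; rewrite setUC. Qed.

Lemma adj_ends F e x y : e \in F -> ends e = [set x; y] -> adj F x y.
Proof. by move=> eF De; apply/existsP; exists e; rewrite eF De /=. Qed.

Lemma ends_neq e x y : ends e = [set x; y] -> x != y.
Proof. by move=> De; have := card_ends e; rewrite De cards2; case: eqP. Qed.

Lemma ends_pair e x y :
  x \in ends e -> y \in ends e -> x != y -> ends e = [set x; y].
Proof.
move=> xe ye xy; apply/esym/eqP; rewrite eqEcard subUset !sub1set xe ye /=.
by rewrite card_ends cards2 xy.
Qed.

Lemma ends_other e x : x \in ends e -> exists y, ends e = [set x; y].
Proof.
move=> xe; have: 0 < #|ends e :\ x|.
  by have := cardsD1 x (ends e); rewrite card_ends xe; lia.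
case/card_gt0P=> y; rewrite !inE eq_sym => /andP[xy ye].
by exists y; apply: ends_pair.
Qed.

Lemma connected_via T T' :
    connected T ->
    (forall e x y, e \in T -> ends e = [set x; y] -> connect (adj T') x y) ->
  connected T'.
Proof.
move=> connT TT' x y; apply: connect_sub (connT x y) => {}x {}y.
by case/existsP=> e /andP[eT /eqP De]; apply: TT' De.
Qed.

(** Let [y] be the other end of [e]. A simple path of [T] from [y] to [x] enters [x] through some
    edge [e']; the rest of the path together with [e] bypasses [e']. *)
Lemma connected_exchange T e x :
    connected T -> x \in ends e ->
  exists e', [/\ e' \in T, x \in ends e' & connected (e |: T :\ e')].
Proof.
move=> connT xe; have [y De] := ends_other xe.
case/connectP: (connT y x) => p0 /shortenP[p]; case/lastP: p => [|p z].
  by move=> _ _ _ /= Dx; have := ends_neq De; rewrite Dx eqxx.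
rewrite last_rcons rcons_path -rcons_cons rcons_uniq => /andP[Tp].
case/existsP=> e' /andP[e'T /eqP De'] /andP[zNp _] _ Dx; subst z.
have xe' : x \in ends e' by rewrite De' !inE eqxx orbT.
exists e'; split=> //; set T' := e |: _.
have sameT' : connect_sym (adj T') by exact/sym_connect_sym/adj_sym.
have yw : connect (adj T') y (last y p).
  apply/connectP; exists p => //.
  (* The path is simple, so [p] avoids [x], an end of [e'], and hence does not traverse [e']. *)
  apply: (sub_in_path (P := predC1 x)) (Tp) => [a b /= ax bx|]; last first.
    by apply/allP=> a ap /=; apply: contraNneq zNp => <-.
  case/existsP=> e1 /andP[e1T /eqP De1]; apply/existsP; exists e1.
  rewrite De1 eqxx andbT !inE e1T andbT orbC; case: (e1 =P e') => //= De1'.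
  by move: xe'; rewrite -De1' De1 !inE eq_sym (negPf ax) eq_sym (negPf bx).
have xw : connect (adj T') x (last y p).
  apply: connect_trans yw; apply: connect1.
  by apply: adj_ends De; rewrite setU11.
apply: connected_via connT _ => e1 a b e1T De1.
have [De1' | e1N] := eqVneq e1 e'; last first.
  by apply/connect1/(adj_ends _ De1); rewrite !inE e1N e1T orbT.
have ab := ends_neq De1.
have: (a \in ends e') && (b \in ends e').
  by rewrite -De1' De1 !inE !eqxx orbT.
rewrite De' !inE => /andP[/orP[]/eqP Da /orP[]/eqP Db]; move: ab;
  by rewrite Da Db ?eqxx // sameT'.
Qed.

(** Each pair carries the edge that leaves its vertex, so the edge of the last pair is not
    traversed; hence [belast]. *)
Lemma connect_walk T (p : vertex G * edge G) c :
    path (fun p q => ends p.2 == [set p.1; q.1]) p c ->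
    all (fun e => e \in T) (unzip2 (belast p c)) ->
  connect (adj T) p.1 (last p c).1.
Proof.
elim: c p => //= q c IHc p /andP[/eqP Dp qc] /andP[pT cT].
exact: connect_trans (connect1 (adj_ends pT Dp)) (IHc q qc cT).
Qed.

Lemma connected_cycleD1 T p c :
  connected T -> is_cycle T (p :: c) -> connected (T :\ p.2).
Proof.
move=> connT /and5P[_ _ /= /andP[pNc _] /andP[pT cT] pc].
apply: connected_via connT _ => e x y eT De.
have [Dep | eNp] := eqVneq e p.2; last first.
  by apply/connect1/(adj_ends _ De); rewrite !inE eNp.
case: c => [|q c] /= in pNc cT pc *.
  by case/andP: pc => /eqP/ends_neq; rewrite eqxx.
case/andP: pc => /eqP Dp qc.
(* The walk from [q] around to [p] uses every edge of the cycle except [p.2]. *)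
have qp : connect (adj (T :\ p.2)) q.1 p.1.
  have := @connect_walk (T :\ p.2) q (rcons c p) qc.
  rewrite last_rcons belast_rcons; apply; apply/allP=> e1 e1c.
  rewrite !inE (@allP _ (fun e => e \in T) (unzip2 (q :: c)) cT) // andbT.
  by apply: contraNneq pNc => <-.
have symT : connect_sym (adj (T :\ p.2)) by exact/sym_connect_sym/adj_sym.
have xy := ends_neq De.
have: (x \in ends p.2) && (y \in ends p.2).
  by rewrite -Dep De !inE !eqxx orbT.
rewrite Dp !inE => /andP[/orP[]/eqP Dx /orP[]/eqP Dy]; move: xy;
  by rewrite Dx Dy ?eqxx // symT.
Qed.

(** An inclusion-minimal connected subset of [F] has no cycle, since an edge of a cycle could be
    deleted. *)
Lemma spanning_tree_exists F :
  connected F -> exists2 T : {set edge G}, T \subset F & spanning_tree T.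
Proof.
pose conn T := [forall x, forall y, connect (adj T) x y].
have connP T : reflect (connected T) (conn T).
  by apply: (iffP forallP) => TT x; [exact/forallP | apply/forallP].
move/connP/minset_exists=> [T /minsetP[/connP connT minT] sTF].
exists T => //; split=> // -[|p c]; first by rewrite /is_cycle.
apply/negP=> Tpc; have pT : p.2 \in T by case/and5P: Tpc => _ _ _ /andP[].
have /connP connT' := connected_cycleD1 connT Tpc.
by have /setP/(_ p.2) := minT _ connT' (subsetDl _ _); rewrite !inE eqxx pT.
Qed.

End Connectedness.

(** * Degrees and packings of disjoint connected sets *)

Section Packing.
Variable G : mgraph.
Implicit Types (F T H M : {set edge G}) (e : edge G) (v x y : vertex G).

Lemma degree_sum F v : degree F v = \sum_(e in F) (v \in ends e).
Proof.
rewrite /degree -sum1_card big_mkcond [RHS]big_mkcond; apply: eq_bigr => e _.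
by rewrite inE; case: (e \in F); case: (v \in ends e).
Qed.

Lemma degreeU1 e F v :
  e \notin F -> degree (e |: F) v = (v \in ends e) + degree F v.
Proof. by move=> eF; rewrite !degree_sum big_setU1. Qed.

Lemma degreeD1 e F v :
  e \in F -> degree F v = (v \in ends e) + degree (F :\ e) v.
Proof. by move=> eF; rewrite !degree_sum (big_setD1 e). Qed.

Lemma degree_subset F H v : F \subset H -> degree F v <= degree H v.
Proof.
move=> sFH; apply/subset_leq_card/subsetP=> e; rewrite !inE => /andP[eF ->].
by rewrite (subsetP sFH).
Qed.

(** Members are only asked to be connected, so acyclicity need not be restored after an exchange. *)
Definition packing m H (T : 'I_m -> {set edge G}) : Prop :=
  [/\ forall i, T i \subset H,
      forall i, connected (T i)
    & forall i j, i != j -> [disjoint T i & T j]].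

Lemma tree_connected_packing m H :
  tree_connected m H <-> exists T : 'I_m -> {set edge G}, packing H T.
Proof.
split=> [[T [sTH treeT dT]] | [T [sTH connT dT]]].
  by exists T; split=> // i; case: (treeT i).
have /fin_all_exists2[S sST treeS] i := spanning_tree_exists (connT i).
exists S; split=> // [i | i j /dT dij].
  exact: subset_trans (sST i) (sTH i).
by apply: disjointWl (sST i) _; apply: disjointWr (sST j) _.
Qed.

(** One edge chosen from each member gives [m] edges, distinct because the members are disjoint. *)
Lemma packing_degree m H (T : 'I_m -> {set edge G}) F v :
    packing H T ->
    (forall i, exists2 e, e \in T i & (e \in F) && (v \in ends e)) ->
  m <= degree F v.
Proof.
move=> [_ _ dT] /fin_all_exists2[h hT hF].
have injh : injective h.
  move=> i j hij; apply/eqP; apply: contraT => /dT/disjointFr/(_ (hT i)).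
  by rewrite hij hT.
rewrite -[m]card_ord -cardsT -(card_imset _ injh).
by apply/subset_leq_card/subsetP=> _ /imsetP[i _ ->]; rewrite inE.
Qed.

Lemma tree_connected_degree m H e v :
  tree_connected m H -> v \in ends e -> m <= degree H v.
Proof.
case/tree_connected_packing=> T packT ve.
apply: (packing_degree packT) => i; have [sTH connT _] := packT.
have [e' [e'T ve' _]] := connected_exchange (connT i) ve.
by exists e' => //; rewrite (subsetP (sTH i)).
Qed.

Lemma tree_connected_subset m H H' :
  H \subset H' -> tree_connected m H -> tree_connected m H'.
Proof.
move=> sHH' [T [sTH treeT dT]]; exists T; split=> // i.
exact: subset_trans (sTH i) sHH'.
Qed.

Lemma tree_connected_exchange m H F e v :
    tree_connected m H -> e \notin H -> v \in ends e ->
    degree (F :&: H) v < m ->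
  exists e', [/\ e' \in H :\: F, v \in ends e'
               & tree_connected m (e |: H :\ e')].
Proof.
case/tree_connected_packing=> T packT eNH ve degFv.
have [sTH connT dT] := packT.
(* Otherwise every member has an edge of [F] at [v], giving [F :&: H] degree at least [m] there. *)
have /existsP[i /exists_inP noF] :
    [exists i, ~~ [exists e in T i, (e \in F :&: H) && (v \in ends e)]].
  apply: contraLR degFv; rewrite -leqNgt => /existsPn allF.
  apply: (packing_degree packT) => i.
  by have := allF i; rewrite negbK => /exists_inP.
have [e' [e'T ve' connT']] := connected_exchange (connT i) ve.
have e'H := subsetP (sTH i) _ e'T.
exists e'; split=> //.
  rewrite inE e'H andbT; apply/negP=> e'F; case: noF; exists e' => //.
  by rewrite inE e'F e'H.
apply/tree_connected_packing.
exists (fun j => if j == i then e |: T i :\ e' else T j); split.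
- move=> j; case: eqP => [_ | /eqP ji]; first exact/setUS/setSD.
  rewrite subsetU // orbC subsetD1 sTH /=.
  by rewrite (disjointFl (dT _ _ ji) e'T).
- by move=> j; case: eqP.
(* The new edge [e] lies outside [H], hence outside every other member. *)
have disjoint_new j : j != i -> [disjoint e |: T i :\ e' & T j].
  move=> ji; apply/pred0P=> e1; rewrite !inE.
  case: (boolP (e1 \in T j)) => [e1Tj | _]; last by rewrite andbF.
  rewrite (disjointFr (dT _ _ ji) e1Tj) andbF orbF andbT.
  by apply: contraNF eNH => /eqP <-; rewrite (subsetP (sTH j)).
move=> j k jk.
case: (j =P i) => [Dj | /eqP ji]; case: (k =P i) => [Dk | /eqP ki].
- by rewrite Dj Dk eqxx in jk.
- exact: disjoint_new.
- by rewrite disjoint_sym disjoint_new.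
- exact: dT.
Qed.

Lemma degree_lt_edge H F v :
  degree H v < degree F v -> exists2 e, e \in F :\: H & v \in ends e.
Proof.
move=> ltHF; have /subsetPn[e] :
    ~~ ([set e in F | v \in ends e] \subset [set e in H | v \in ends e]).
  by apply: contraL ltHF => /subset_leq_card; rewrite -leqNgt.
rewrite !inE => /andP[eF ve]; rewrite ve andbT => eNH.
by exists e; rewrite ?inE ?eNH.
Qed.

Lemma small_end_augment m F M H :
    tree_connected m M ->
    (forall e, e \in F :\: M -> exists2 x, x \in ends e & degree F x <= m) ->
    F :&: M \subset H -> H \subset F :|: M -> tree_connected m H ->
    (forall v, degree H v + m <= maxn (degree F v) m + degree M v) ->
  exists H', [/\ H' \subset F :|: M, tree_connected m H',
      forall v, degree F v <= degree H' v
    & forall v, degree H' v + m <= maxn (degree F v) m + degree M v].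
Proof.
move=> connM smallF; have [n] := ubnP #|F :\: H|; elim: n H => // n IHn H ltn.
move=> sFMH sHFM connH ubH.
have [/forallP geF | /forallPn[u]] :=
    boolP [forall v, degree F v <= degree H v]; first by exists H.
rewrite -ltnNge => ltHF; have [e /setDP[eF eNH] ue] := degree_lt_edge ltHF.
have lemH := tree_connected_degree connH ue.
have lemM := tree_connected_degree connM ue.
have eNM : e \notin M.
  by apply: contra eNH => eM; apply: (subsetP sFMH); rewrite inE eF.
have [|t te smallt] := smallF e; first by rewrite inE eNM.
have ut : u != t by apply: contraTneq smallt => <-; lia.
have De := ends_pair ue te ut.
have [|e' [/setDP[e'H e'NF] te' connH']] :=
    tree_connected_exchange (F := F) connH eNH te.
  (* At [t], the set [F] has at most [m] edges, and one of them, [e], is not in [H]. *)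
  apply: leq_trans smallt; rewrite (degreeD1 t eF) te ltnS.
  apply/degree_subset/subsetP=> e1; rewrite !inE => /andP[-> e1H].
  by rewrite andbT; apply: contraNneq eNH => <-.
have eNH' : e \notin H :\ e' by rewrite inE (negPf eNH) andbF.
have degH' v :
    degree (e |: H :\ e') v + (v \in ends e') = (v \in ends e) + degree H v.
  by rewrite degreeU1 // (degreeD1 v e'H) -addnA (addnC (degree _ _)).
apply: (IHn (e |: H :\ e')) => //.
- rewrite -ltnS; apply: leq_trans ltn; rewrite ltnS; apply: proper_card.
  apply/properP; split; last by exists e; rewrite !inE ?eqxx ?eNH.
  apply/subsetP=> e1; rewrite !inE => /andP[+ e1F]; rewrite e1F andbT.
  case: (e1 =P e) => //= _; apply: contra => ->; rewrite andbT.
  by apply: contraNneq e'NF => <-.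
- apply/subsetP=> e1 e1FM; have := subsetP sFMH _ e1FM; rewrite !inE => ->.
  rewrite andbT orbC; apply/orP; left; apply: contraNneq e'NF => <-.
  by case/setIP: e1FM.
- apply/subsetP=> e1; rewrite in_setU1 => /predU1P[-> | /setD1P[_]].
    by rewrite inE eF.
  exact: (subsetP sHFM).
(* Only the degree of [u] can grow; it stays at most that of [F], which suffices because [M] has
   degree at least [m] at [u]. *)
- move=> v; have := degH' v; have := ubH v.
  rewrite De !inE; have [-> _ degH'u | _] /= := eqVneq v u.
    have: degree (e |: H :\ e') u <= degree F u.
      by apply: leq_trans ltHF; rewrite -add1n -degH'u leq_addr.
    by clear -lemM; lia.
  by have [-> | _] /= := eqVneq v t; rewrite ?te'; clear; lia.
Qed.

Lemma tree_connected_degree_between m F M :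
    tree_connected m M ->
  exists H, [/\ H \subset F :|: M, tree_connected m H,
      forall v, degree F v <= degree H v
    & forall v, degree H v + m <= maxn (degree F v) m + degree M v].
Proof.
move=> connM; have [n] := ubnP #|F|; elim: n F => // n IHn F ltn.
have [/exists_inP[e] | noBig] := boolP
    [exists e in F :\: M, [forall x in ends e, m < degree F x]]; last first.
  apply: (@small_end_augment _ _ _ M) => //; last by move=> v; lia.
  - move=> e eFM; apply/exists_inP; apply: contraNT noBig => /exists_inPn small.
    apply/exists_inP; exists e => //; apply/forall_inP=> x /small.
    by rewrite -ltnNge.
  - exact: subsetIr.
  - exact: subsetUr.
case/setDP=> eF eNM /forall_inP bigF.
have [|H [sHF connH lbH ubH]] := IHn (F :\ e).
  by have := cardsD1 e F; rewrite eF; lia.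
(* [H] lies in the union of [F :\ e] and [M], neither of which contains [e]. *)
have eNH : e \notin H.
  by apply: contra eNM => /(subsetP sHF); rewrite !inE eqxx.
exists (e |: H); split.
- apply/subsetP=> e1; rewrite in_setU1 => /predU1P[-> | /(subsetP sHF)].
    by rewrite inE eF.
  by rewrite !inE => /orP[/andP[_ ->] | ->]; rewrite ?orbT.
- exact: tree_connected_subset (subsetUr _ _) connH.
- by move=> v; rewrite degreeU1 // (degreeD1 v eF) leq_add2l.
(* At an end of [e] the degree in [F] exceeds [m], so the maximum is one larger for [F] than for
   [F :\ e]. *)
- move=> v; have := ubH v; have := bigF v.
  rewrite degreeU1 // (degreeD1 v eF).
  by case: (v \in ends e) => [/(_ isT) |]; clear; lia.
Qed.

End Packing.

Theorem theorem1p3 (G : mgraph) (m : nat) (g f f' : vertex G -> nat)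
    (m_gt0 : 0 < m)
    (le_gf : forall v, g v <= f v)
    (le_mf : forall v, m <= f v)
    (le_mf' : forall v, m <= f' v)
    (gf_factor : exists F : {set edge G}, is_factor g f F)
    (mf'_factor : exists F : {set edge G},
        is_factor (fun=> m) f' F /\ tree_connected m F) :
  exists H : {set edge G},
    is_factor g (fun v => f v + f' v - m) H /\ tree_connected m H.
Proof.
case: gf_factor => F factF; case: mf'_factor => M [factM connM].
have [H [_ connH lbH ubH]] := tree_connected_degree_between F connM.
exists H; split=> // v.
(* Since [m <= f v], the maximum of [degree F v] and [m] is at most [f v]. *)
have := factF v; have := factM v; have := lbH v; have := ubH v.
by have := le_mf v; lia.
Qed.
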